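(* Let $q$ be an odd prime power. For any $\theta_1,\theta_2\in\mathbb{F}_{q^6}$ with $\theta_i^2+\theta_i=1$ ($i=1,2$), put $f_i(x)=x^q+x^{q^3}+\theta_i x^{q^5}$. Then the linear sets $L_{f_1}$ and $L_{f_2}$ in $\mathrm{PG}(1,q^6)$ are $\mathrm{P\Gamma L}(2,q^6)$-equivalent. That is, all elements of the family $\{L_f : f(x)=x^q+x^{q^3}+\theta x^{q^5},\ \theta\in\mathbb{F}_{q^6},\ \theta^2+\theta=1\}$ are $\mathrm{P\Gamma L}$-equivalent.
   Context: For a $q$-polynomial $h$ over $\mathbb{F}_{q^n}$, $L_h=\{\langle (x,h(x))\rangle_{\mathbb{F}_{q^n}} : x\in\mathbb{F}_{q^n}^*\}$, a set of points of the projective line $\mathrm{PG}(1,q^n)$. Two point sets $L,L'$ of $\mathrm{PG}(1,q^n)$ are $\mathrm{P\Gamma L}$-equivalent if there exists $\varphi\in\mathrm{P\Gamma L}(2,q^n)$ with $L^\varphi=L'$. *)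

(* Defs.v *)
From HB Require Import structures.
From mathcomp Require Import all_boot all_order all_algebra all_fingroup.

Set Implicit Arguments.
Unset Strict Implicit.
Unset Printing Implicit Defensive.

Import GRing.Theory.
Local Open Scope ring_scope.

Definition prime_power (q : nat) : Prop :=
  exists p k : nat, [/\ prime p, (0 < k)%N & q = (p ^ k)%N].

Section ProjectiveLine.
Variable F : finFieldType.

Local Notation V := 'rV[F]_2.

Definition line_set (v : V) : {set V} := [set w | w \in <[v]>%VS].

(* The points of PG(1, F) are the one-dimensional subspaces of F^2, kept as
   finite sets of vectors so that semilinear maps act on them by direct image. *)
Definition is_point (P : {set V}) : bool :=
  [exists v : V, (v != 0) && (P == line_set v)].

Definition PG1 : finType := {P : {set V} | is_point P}.

Definition semilinear (g : V -> V) : Prop :=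
  exists sigma : {rmorphism F -> F},
    [/\ bijective sigma,
        forall u v, g (u + v) = g u + g v
      & forall a v, g (a *: v) = sigma a *: g v].

(* PGammaL(2, F) acts faithfully on PG(1, F); it is identified with the
   permutations induced by the invertible semilinear maps of F^2. *)
Definition PGammaL (phi : {perm PG1}) : Prop :=
  exists g : V -> V,
    [/\ bijective g, semilinear g & forall P : PG1, val (phi P) = g @: val P].

Definition PGammaL_equiv (L L' : {set PG1}) : Prop :=
  exists2 phi : {perm PG1}, PGammaL phi & phi @: L = L'.

Definition vec2 (x y : F) : V := \row_(i < 2) (if i == ord0 then x else y).

(* The definition makes sense for every polynomial h; only q-polynomials, i.e.
   combinations of the monomials 'X^(q ^ i), give linear sets. *)
Definition linear_set (h : {poly F}) : {set PG1} :=
  [set P : PG1 | [exists x : F, (x != 0) && (val P == line_set (vec2 x h.[x]))]].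

Definition qtrinomial (q : nat) (theta : F) : {poly F} :=
  'X^q + 'X^(q ^ 3) + theta *: 'X^(q ^ 5).

End ProjectiveLine.

(* Main.v *)
From HB Require Import structures.
Require Import Defs.
From mathcomp Require Import all_boot all_order all_algebra all_fingroup.
From mathcomp Require Import finfield ring.

Set Implicit Arguments.
Unset Strict Implicit.

Import GRing.Theory.
Local Open Scope ring_scope.

(** If [theta1 <> theta2], they are the two roots of [X^2 + X - 1], so that
[theta1 + theta2 = theta1 * theta2 = -1]. When [theta1 ^+ q <> theta1], the
[q]-Frobenius exchanges the two roots and maps one linear set to the other.
When both roots lie in [F_q], the inverse of [f_1] is
[h = theta2 x^q + x^(q^3) + x^(q^5)], so swapping the coordinates maps [L_{f_1}]
to [L_h]. Now [h] is also the adjoint of [f_2] for the trace form; since [f - m]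
and its adjoint have kernels of the same size for every [m], a polynomial and
its adjoint define the same linear set, and [L_h = L_{f_2}]. *)

(** * Points of the projective line and semilinear maps *)

Section ProjectiveLine.
Variable F : finFieldType.
Local Notation V := 'rV[F]_2.

Lemma line_setZ (c : F) (v : V) : c != 0 -> line_set (c *: v) = line_set v.
Proof.
move=> c0; apply/setP=> w; rewrite !inE; apply/vlineP/vlineP => -[k ->].
  by exists (k * c); rewrite scalerA.
by exists (k / c); rewrite scalerA divfK.
Qed.

Lemma vec2Z (c x y : F) : c *: vec2 x y = vec2 (c * x) (c * y).
Proof. by apply/rowP=> i; rewrite !mxE; case: ifP. Qed.

Lemma vec2_neq0 (x y : F) : x != 0 -> vec2 x y != 0.
Proof. by apply: contraNneq => /rowP/(_ ord0); rewrite !mxE /= => ->. Qed.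

(** Only the slope matters: comparing linear sets becomes comparing the sets of ratios [h.[x] /
    x]. *)
Lemma line_set_vec2 (x m : F) : x != 0 ->
  line_set (vec2 x (m * x)) = line_set (vec2 1 m).
Proof. by move=> x0; rewrite -(line_setZ (vec2 1 m) x0) vec2Z mulr1 mulrC. Qed.

Section Semilinear.
Variable g : V -> V.
Hypotheses (bij_g : bijective g) (sl_g : Defs.semilinear g).

Lemma semilinear_line_set (v : V) : g @: line_set v = line_set (g v).
Proof.
have [sigma [[tau _ tauK] _ gZ]] := sl_g.
apply/setP=> w; rewrite !inE; apply/imsetP/vlineP.
  by move=> [u]; rewrite inE => /vlineP [k ->] ->; exists (sigma k).
move=> [k ->]; exists (tau k *: v); last by rewrite gZ tauK.
by rewrite inE; apply/vlineP; exists (tau k).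
Qed.

Lemma semilinear_eq0 (v : V) : (g v == 0) = (v == 0).
Proof.
have [sigma [_ _ gZ]] := sl_g.
have g0 : g 0 = 0 by have := gZ 0 0; rewrite rmorph0 !scale0r.
by rewrite -{1}g0 (bij_eq bij_g).
Qed.

Lemma semilinear_point (P : PG1 F) : is_point (g @: val P).
Proof.
case: P => P /= /existsP [v /andP [v0 /eqP ->]].
apply/existsP; exists (g v).
by rewrite semilinear_eq0 v0 semilinear_line_set eqxx.
Qed.

Lemma semilinear_PGammaL :
  exists2 phi : {perm PG1 F}, PGammaL phi & forall P, val (phi P) = g @: val P.
Proof.
pose f (P : PG1 F) : PG1 F := Sub (g @: val P) (semilinear_point P).
have f_inj : injective f.
  move=> P Q /(congr1 val) /= eqPQ; apply: val_inj.
  exact: (imset_inj (bij_inj bij_g) eqPQ).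
have phiE P : val (perm f_inj P) = g @: val P by rewrite permE.
by exists (perm f_inj) => //; exists g.
Qed.

(** The two hypotheses are the two inclusions. They compare points only, so [g] need not carry the
    graph of [h] onto that of [h']; the coordinate swap relies on this freedom. *)
Lemma semilinear_PGammaL_equiv (h h' : {poly F}) :
    (forall x, x != 0 -> exists2 y, y != 0 &
       line_set (g (vec2 x h.[x])) = line_set (vec2 y h'.[y])) ->
    (forall y, y != 0 -> exists2 x, x != 0 &
       line_set (g (vec2 x h.[x])) = line_set (vec2 y h'.[y])) ->
  PGammaL_equiv (linear_set h) (linear_set h').
Proof.
move=> hom surj; have [phi phiP phiE] := semilinear_PGammaL.
exists phi => //; apply/setP=> Q; apply/imsetP/idP.
  move=> [P]; rewrite inE => /existsP [x /andP [x0 /eqP Px]] ->.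
  rewrite inE; have [y y0 xy] := hom x x0; apply/existsP; exists y.
  by rewrite y0 phiE Px semilinear_line_set xy eqxx.
rewrite inE => /existsP [y /andP [y0 /eqP Qy]].
have [x x0 xy] := surj y y0.
have ptx : is_point (line_set (vec2 x h.[x])).
  by apply/existsP; exists (vec2 x h.[x]); rewrite vec2_neq0 ?eqxx.
exists (Sub (line_set (vec2 x h.[x])) ptx).
  by rewrite inE; apply/existsP; exists x; rewrite x0 SubK eqxx.
by apply: val_inj; rewrite phiE SubK semilinear_line_set xy.
Qed.

End Semilinear.

Lemma PGammaL_equiv_refl (L : {set PG1 F}) : PGammaL_equiv L L.
Proof.
have id_sl : Defs.semilinear (@id V) by exists idfun; split=> //; exists id.
have id_bij : bijective (@id V) by exists id.
have [phi phiP phiE] := semilinear_PGammaL id_bij id_sl.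
exists phi => //; rewrite -[RHS]imset_id; apply: eq_imset => P.
by apply: val_inj; rewrite phiE imset_id.
Qed.

Definition swap_coord (v : V) : V := vec2 (v ord0 (lift ord0 ord0)) (v ord0 ord0).

Lemma swap_coord_vec2 x y : swap_coord (vec2 x y) = vec2 y x.
Proof. by rewrite /swap_coord !mxE. Qed.

Lemma swap_coord_bij : bijective swap_coord.
Proof.
exists swap_coord => v; rewrite swap_coord_vec2; apply/rowP=> i; rewrite !mxE;
  by case: (unliftP ord0 i) => [j ->|->] //=; rewrite (ord1 j).
Qed.

Lemma swap_coord_semilinear : Defs.semilinear swap_coord.
Proof.
exists idfun; split=> [|u v|a v]; first by exists id.
  by apply/rowP=> i; rewrite !mxE; case: ifP.
by apply/rowP=> i; rewrite !mxE; case: ifP.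
Qed.

End ProjectiveLine.

(** * Kernels and eigenvalues of adjoint maps, by counting *)

Section Adjoint.
Variables (F : finFieldType) (T : F -> F) (z0 : F).
Hypotheses (T0 : T 0 = 0) (Tz0 : T z0 != 0).

Let c := #|[pred w | T w == 0]|.

(** Multiplication by a nonzero [z] permutes [F], so the count does not depend on [z]. *)
Lemma card_zeros_mul (z : F) :
  #|[pred y | T (y * z) == 0]| = if z == 0 then #|F| else c.
Proof.
case: eqP => [-> | /eqP z0'].
  by apply: eq_card => y; rewrite !inE mulr0 T0 eqxx.
rewrite -(card_image (mulIf z0') [pred y | T (y * z) == 0]).
apply: eq_card => w; rewrite !inE; apply/imageP/idP => [[y yP ->] // | wP].
by exists (w / z); rewrite ?inE divfK.
Qed.

Lemma sum_card_zeros (g : F -> F) (k := #|[pred x | g x == 0]|) :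
  (\sum_x #|[pred y | T (y * g x)%R == 0%R]| = k * #|F| + (#|F| - k) * c)%N.
Proof.
rewrite (bigID [pred x | g x == 0]) /=; congr addn.
  rewrite -sum_nat_const; apply: eq_bigr => x gx0.
  by rewrite card_zeros_mul gx0.
have -> : (#|F| - k = #|[predC [pred x | g x == 0%R]]|)%N.
  by rewrite -(cardC [pred x | g x == 0]) addKn.
rewrite -sum_nat_const; apply: eq_bigr => x /negPf gx0.
by rewrite card_zeros_mul gx0.
Qed.

(* Both kernels are read off the number of pairs [(x, y)] with
   [T (y * g x) = 0], which depends injectively on the size of either one. *)
Lemma card_ker_adjoint (g g' : F -> F) :
    (forall x y, T (y * g x) = T (g' y * x)) ->
  #|[pred x | g x == 0]| = #|[pred y | g' y == 0]|.
Proof.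
move=> adj; have : (\sum_x #|[pred y | T (y * g x)%R == 0%R]| =
                    \sum_y #|[pred x | T (x * g' y)%R == 0%R]|)%N.
  under eq_bigr do rewrite -sum1_card big_mkcond.
  rewrite exchange_big /=; apply: eq_bigr => y _.
  rewrite -sum1_card [RHS]big_mkcond; apply: eq_bigr => x _.
  by rewrite !inE adj mulrC.
rewrite !sum_card_zeros.
(* [z0] is not a zero of [T]; this strict inequality is what later allows cancelling [N - d]. *)
have c_lt : (c < #|F|)%N.
  by rewrite -(cardC [pred w | T w == 0]) -addn1 leq_add2l; apply/card_gt0P;
    exists z0; rewrite !inE.
set k := #|[pred x | g x == 0]|; set k' := #|[pred y | g' y == 0]|.
have kF : (k <= #|F|)%N := max_card _; have k'F : (k' <= #|F|)%N := max_card _.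
move: (#|F|) c c_lt kF k'F => N d d_lt kN k'N E.
(* The count is affine in the kernel size [j], with positive slope [N - d]. *)
have split j : (j <= N)%N -> (j * N + (N - j) * d = j * (N - d) + N * d)%N.
  by move=> jN; rewrite mulnBl mulnBr addnBA ?leq_mul2r ?jN ?orbT //
    addnBAC ?leq_mul2l ?(ltnW d_lt) ?orbT.
move: E; rewrite !split // => /addIn /eqP.
by rewrite eqn_pmul2r ?subn_gt0 // => /eqP.
Qed.

(** Multiplication by [m] is self-adjoint for [T (x * y)], so [g - m] and [g' - m] are adjoint and
    their kernels have equal size. An eigenvector is a second kernel element besides 0. *)
Lemma adjoint_eigenvalue (g g' : F -> F) (m y : F) :
    g 0 = 0 -> g' 0 = 0 -> {morph T : u v / u - v} ->
    (forall x y, T (y * g x) = T (g' y * x)) ->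
  y != 0 -> g y = m * y -> exists2 x, x != 0 & g' x = m * x.
Proof.
move=> g0 g'0 TB adj y0 gy.
have cardE : #|[pred x | g x - m * x == 0]| = #|[pred x | g' x - m * x == 0]|.
  apply: card_ker_adjoint => x z; rewrite mulrBr mulrBl !TB adj.
  by congr (_ - T _); rewrite mulrCA mulrA.
have : (1 < #|[pred x | (g' x - m * x)%R == 0%R]|)%N.
  rewrite -cardE; apply/card_gt1P; exists y, 0.
  by rewrite !inE g0 mulr0 subr0 gy subrr eqxx.
move=> /card_gt1P [a [b [a_in b_in ab]]]; rewrite !inE !subr_eq0 in a_in b_in.
have [az|an] := eqVneq a 0; last by exists a => //; apply/eqP.
by exists b; [rewrite -az eq_sym | apply/eqP].
Qed.

End Adjoint.

(** * The Frobenius map, the trace, and the adjoint and inverse of the trinomials *)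

Section Frobenius.
Variables (F : finFieldType) (q : nat).
Hypotheses (charF_q : [pchar F].-nat q) (hF : #|F| = (q ^ 6)%N).

Lemma frobD k (x y : F) : (x + y) ^+ (q ^ k) = x ^+ (q ^ k) + y ^+ (q ^ k).
Proof. by apply: exprDn_pchar; rewrite pnatX charF_q. Qed.

Lemma frob0 k : (0 : F) ^+ (q ^ k) = 0.
Proof. by case/andP: charF_q => q_gt0 _; rewrite expr0n expn_eq0 eqn0Ngt q_gt0. Qed.

Lemma frobN k (x : F) : (- x) ^+ (q ^ k) = - x ^+ (q ^ k).
Proof.
by apply/eqP; rewrite -addr_eq0 -frobD addNr frob0.
Qed.

Lemma frob_comp k l (x : F) : (x ^+ (q ^ k)) ^+ (q ^ l) = x ^+ (q ^ (k + l)).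
Proof. by rewrite -exprM expnD. Qed.

Lemma frob6D k (x : F) : x ^+ (q ^ (6 + k)) = x ^+ (q ^ k).
Proof. by rewrite -frob_comp -hF expf_card. Qed.

Lemma frob6 (x : F) : x ^+ (q ^ 6) = x.
Proof. by rewrite -hF expf_card. Qed.

Lemma frob_rmorphism :
  exists2 sigma : {rmorphism F -> F}, bijective sigma & sigma =1 (fun x => x ^+ q).
Proof.
pose f (x : F) := x ^+ q.
have fB : zmod_morphism f.
  by move=> x y; rewrite /f -(expn1 q) frobD frobN.
have fM : monoid_morphism f.
  by split=> [|x y]; rewrite /f ?expr1n ?exprMn.
pose fA := GRing.isZmodMorphism.Build F F f fB.
pose fR := GRing.isMonoidMorphism.Build F F f fM.
pose sigma : {rmorphism F -> F} := HB.pack f fA fR.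
(* The sixth iterate of the Frobenius is the identity, so the fifth is its inverse. *)
exists sigma => //; exists (fun x => x ^+ (q ^ 5)) => x.
  by rewrite /= /f -{1}(expn1 q) frob_comp frob6.
by rewrite /= /f -{2}(expn1 q) frob_comp frob6.
Qed.

(** The trace from the field of order [q ^ 6] to its subfield of order [q]. *)
Definition frob_trace (z : F) : F := \sum_(i < 6) z ^+ (q ^ i).

Lemma frob_traceB : {morph frob_trace : x y / x - y}.
Proof.
by move=> x y; rewrite /frob_trace -sumrB; apply: eq_bigr => i _;
  rewrite frobD frobN.
Qed.

Lemma frob_trace_frob k (z : F) : frob_trace (z ^+ (q ^ k)) = frob_trace z.
Proof.
elim: k => [|k IHk]; first by rewrite expr1.
rewrite -addn1 -frob_comp -{}IHk; move: (z ^+ _) => {}z.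
(* One Frobenius shifts the six terms cyclically: the last becomes [z ^+ (q ^ 6) = z], the first. *)
rewrite /frob_trace big_ord_recr [RHS]big_ord_recl /= frob_comp frob6 expr1.
rewrite addrC; congr (_ + _); apply: eq_bigr => i _.
by rewrite frob_comp.
Qed.

(** The trace is a nonzero polynomial of degree at most [q ^ 5], too small to vanish on all [q ^ 6]
    elements. *)
Lemma frob_trace_neq0 : exists z, frob_trace z != 0.
Proof.
apply/existsP; apply: contraT => /existsPn /= tr0.
have q_gt1 : (1 < q)%N.
  by have := finNzRing_gt1 F; rewrite hF; case: q => [|[|]].
pose p : {poly F} := \sum_(i < 6) 'X^(q ^ i).
have p_neq0 : p != 0.
  (* The coefficient of ['X] is 1, since for [i > 0] the exponent [q ^ i] differs from 1. *)
  apply/eqP => /(congr1 (fun r : {poly F} => r`_1)).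
  rewrite coef0 coef_sum big_ord_recl big1 /= => [|i _].
    by rewrite coefXn addr0; apply/eqP; rewrite oner_eq0.
  by rewrite coefXn -[X in X == _](expn0 q) eqn_exp2l.
have p_size : (size p <= (q ^ 5).+1)%N.
  apply: (leq_trans (size_sum _ _ _)); apply/bigmax_leqP => i _.
  by rewrite size_polyXn ltnS leq_exp2l // -ltnS.
have p_roots : all (root p) (enum F).
  apply/allP => x _; rewrite /root /p horner_sum.
  under eq_bigr do rewrite hornerXn.
  exact: negbNE (tr0 x).
have := max_poly_roots p_neq0 p_roots (enum_uniq _); rewrite -cardE hF.
by move=> /leq_trans /(_ p_size); rewrite ltnS leqNgt ltn_exp2l.
Qed.

Lemma qtrinomialE (theta x : F) :
  (qtrinomial q theta).[x] = x ^+ (q ^ 1) + x ^+ (q ^ 3) + theta * x ^+ (q ^ 5).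
Proof. by rewrite /qtrinomial !hornerE. Qed.

(** Taking adjoints for the trace form exchanges the exponents [q ^ i] and [q ^ (6 - i)]; so, for
    [theta] fixed by the Frobenius, the coefficient moves from [q ^ 5] to [q]. *)
Definition qadj (theta x : F) : F :=
  theta * x ^+ (q ^ 1) + x ^+ (q ^ 3) + x ^+ (q ^ 5).

Lemma qtrinomial_adj (theta x y : F) : theta ^+ q = theta ->
  frob_trace (y * (qtrinomial q theta).[x]) = frob_trace (qadj theta y * x).
Proof.
move=> theta_q.
have TD u v : frob_trace (u + v) = frob_trace u + frob_trace v.
  by rewrite /frob_trace -big_split; apply: eq_bigr => i _; rewrite frobD.
rewrite qtrinomialE /qadj !mulrDr !mulrDl !TD.
(* Raising the argument of a trace to the power [q ^ (6 - i)] turns [x ^+ (q ^ i)] into [x] and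
   moves the Frobenius onto [y]. *)
rewrite -(frob_trace_frob 5 (y * x ^+ _)) -(frob_trace_frob 3 (y * x ^+ (q ^ 3))).
rewrite -(frob_trace_frob 1 (y * (theta * _))) !exprMn !frob_comp !frob6.
by rewrite expn1 theta_q; set u := frob_trace _; set v := frob_trace _;
  rewrite [y ^+ q * _]mulrCA mulrA; ring.
Qed.

Section Inverse.
Variables theta1 theta2 : F.
Hypotheses (sum_theta : theta1 + theta2 = -1) (prod_theta : theta1 * theta2 = -1).
Hypothesis theta2_q : theta2 ^+ q = theta2.

Lemma theta2_frob k : theta2 ^+ (q ^ k) = theta2.
Proof. by elim: k => [|k IHk]; rewrite ?expr1 // expnS exprM theta2_q. Qed.

Lemma qtrinomial_qadjK y : (qtrinomial q theta1).[qadj theta2 y] = y.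
Proof.
rewrite qtrinomialE /qadj !frobD !exprMn !frob_comp !theta2_frob !add1n.
rewrite !(frob6D 2) !(frob6D 4) !frob6.
(* Sums of two odd exponents are even modulo 6, so only [y], [y ^+ (q ^ 2)] and [y ^+ (q ^ 4)]
   occur. The relations on the roots make the coefficients 1, 0 and 0. *)
transitivity ((theta1 + theta2 + 1) * (y ^+ (q ^ 2) + y ^+ (q ^ 4))
              + (theta1 * theta2 + 2) * y); last first.
  by rewrite sum_theta prod_theta; ring.
ring.
Qed.

(** On a finite set a one-sided inverse is two-sided. *)
Lemma qadj_qtrinomialK : cancel (horner (qtrinomial q theta1)) (qadj theta2).
Proof.
have qadj_inj : injective (qadj theta2) := can_inj qtrinomial_qadjK.
have [r _ rK] := injF_bij qadj_inj.
by move=> x; rewrite -[x in LHS]rK qtrinomial_qadjK.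
Qed.

End Inverse.

End Frobenius.

(** * The two equivalences: Frobenius and coordinate swap *)

Section Equivalence.
Variables (F : finFieldType) (q : nat).
Hypotheses (charF_q : [pchar F].-nat q) (hF : #|F| = (q ^ 6)%N).

Lemma qtrinomial_frob_equiv (theta : F) :
  PGammaL_equiv (linear_set (qtrinomial q theta))
                (linear_set (qtrinomial q (theta ^+ q))).
Proof.
have [sigma bij_sigma sigmaE] := frob_rmorphism charF_q hF.
pose g (v : 'rV[F]_2) := map_mx sigma v.
have g_sl : Defs.semilinear g.
  by exists sigma; split=> // [u v|a v]; rewrite /g ?map_mxD ?map_mxZ.
have g_bij : bijective g.
  have [tau sigmaK tauK] := bij_sigma.
  by exists (map_mx tau) => v; apply/matrixP => i j; rewrite !mxE.
have gE x : g (vec2 x (qtrinomial q theta).[x]) =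
            vec2 (sigma x) (qtrinomial q (theta ^+ q)).[sigma x].
  apply/rowP=> i; rewrite !mxE; case: ifP => // _.
  by rewrite !qtrinomialE !rmorphD rmorphM /= !rmorphXn !sigmaE.
apply: (semilinear_PGammaL_equiv g_bij g_sl) => x x0.
  by exists (sigma x); rewrite ?fmorph_eq0 ?gE.
have [tau sigmaK tauK] := bij_sigma.
exists (tau x); last by rewrite gE tauK.
by rewrite -(fmorph_eq0 sigma) tauK.
Qed.

Lemma qtrinomial_swap_equiv (theta1 theta2 : F) :
    theta1 + theta2 = -1 -> theta1 * theta2 = -1 -> theta2 ^+ q = theta2 ->
  PGammaL_equiv (linear_set (qtrinomial q theta1))
                (linear_set (qtrinomial q theta2)).
Proof.
move=> sumt prodt t2q.
have qX0 := frob0 charF_q.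
set f1 := qtrinomial q theta1; set f2 := qtrinomial q theta2.
pose h := qadj q theta2.
have f2_0 : f2.[0] = 0 by rewrite qtrinomialE !qX0 mulr0 !addr0.
have h_0 : h 0 = 0 by rewrite /h /qadj !qX0 mulr0 !addr0.
have f1_0 : f1.[0] = 0 by rewrite qtrinomialE !qX0 mulr0 !addr0.
have f1K : cancel (horner f1) h := qadj_qtrinomialK charF_q hF sumt prodt t2q.
have hK y : f1.[h y] = y := qtrinomial_qadjK charF_q hF sumt prodt t2q y.
have T0 : frob_trace q (0 : F) = 0 by apply: big1 => i _; exact: qX0.
have [z Tz] := frob_trace_neq0 hF.
have TB := frob_traceB charF_q.
have adj x y := qtrinomial_adj charF_q hF x y t2q.
apply: (semilinear_PGammaL_equiv (swap_coord_bij F) (swap_coord_semilinear F)).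
  move=> x x0; rewrite swap_coord_vec2.
  have u0 : f1.[x] != 0 by apply: contraNneq x0 => E; rewrite -(f1K x) E h_0.
  (* The slope of the swapped point is an eigenvalue of [h], with eigenvector [f1.[x]], hence also
     one of its adjoint [f2]. *)
  pose m := x / f1.[x]; have xE : x = m * f1.[x] by rewrite divfK.
  have [y y0 yE] : exists2 y, y != 0 & f2.[y] = m * y.
    apply: (adjoint_eigenvalue T0 Tz h_0 f2_0 TB _ u0) => [a b|].
      by rewrite mulrC -adj mulrC.
    by rewrite f1K.
  by exists y => //; rewrite yE {2}xE !line_set_vec2.
move=> y y0; pose m := f2.[y] / y.
have yE : f2.[y] = m * y by rewrite divfK.
have [u u0 uE] := adjoint_eigenvalue T0 Tz f2_0 h_0 TB adj y0 yE.
(* Since [f1] sends [h u] to [u], swapping its graph point at [h u] gives the vector [(u, h u)], of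
   slope [m]. *)
exists (h u); first by apply: contraNneq u0 => E; rewrite -(hK u) E f1_0.
by rewrite swap_coord_vec2 hK uE yE !line_set_vec2.
Qed.

End Equivalence.

Theorem theorem3p4 (q : nat) (hq : prime_power q) (hodd : odd q)
    (F : finFieldType) (hF : #|F| = (q ^ 6)%N) (theta1 theta2 : F)
    (h1 : theta1 ^+ 2 + theta1 = 1) (h2 : theta2 ^+ 2 + theta2 = 1) :
  PGammaL_equiv (linear_set (qtrinomial q theta1))
                (linear_set (qtrinomial q theta2)).
Proof.
have charF_q : [pchar F].-nat q.
  case: hq hF => p [k [p_pr _ ->]]; rewrite -expnM => /card_finPcharP charFp.
  by rewrite pnatX pnatE ?charFp.
have roots2 t : t ^+ 2 + t = 1 -> t != theta1 -> t + theta1 = -1.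
  move=> ht neq; apply/eqP; rewrite -subr_eq0 opprK.
  (* The difference of the two quadratic equations factors through [t - theta1], which can be
     cancelled. *)
  rewrite -(mulrI_eq0 _ (mulfI (_ : t - theta1 != 0))) ?subr_eq0 //.
  have -> : (t - theta1) * (t + theta1 + 1) = t ^+ 2 + t - (theta1 ^+ 2 + theta1).
    by ring.
  by rewrite ht h1 subrr.
have [<-|neq] := eqVneq theta2 theta1; first exact: PGammaL_equiv_refl.
have sumt := roots2 theta2 h2 neq.
have frob_root (t : F) : t ^+ 2 + t = 1 -> (t ^+ q) ^+ 2 + t ^+ q = 1.
  by move=> ht; rewrite exprAC -(expn1 q) -frobD // ht expr1n.
have [t1q|t1q] := eqVneq (theta1 ^+ q) theta1; last first.
  (* [theta1 ^+ q] is again a root and differs from [theta1], so it is the other one. *)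
  suff <- : theta1 ^+ q = theta2 by exact: qtrinomial_frob_equiv.
  by apply: (addIr theta1); rewrite sumt roots2 ?frob_root.
have t2E : theta2 = -1 - theta1 by rewrite -sumt addrK.
apply: qtrinomial_swap_equiv => //; first by rewrite addrC.
  by rewrite t2E mulrBr mulrN1 -opprD -expr2 addrC h1.
by rewrite t2E -(expn1 q) frobD // !frobN // expr1n expn1 t1q.
Qed.
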